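(* Let $A\in\mathbb{R}^{n\times n}$ be symmetric positive semidefinite, let $B\in\mathbb{R}^{n\times n}$ be symmetric positive definite, let $\rho\ge1$, and let $P\in\mathbb{R}^{n\times n}$ be an invertible matrix such that $\tilde B:=P^{-T}BP^{-1}=I$. Put $\tilde A=P^{-T}AP^{-1}$. Then the Split-Merge algorithm for the generalized eigenvalue problem of $(A,B)$ is equivalent to the Split-Merge algorithm for the standard eigenvalue problem of $\tilde A$ in the transformed domain $y=Px$: if $y_0=Px_0$, $\{x_k\}$ is generated from $x_0$ by the Split-Merge iteration for $(A,B)$, $\{y_k\}$ is generated from $y_0$ by the Split-Merge iteration for $\tilde A$ (with the same $\rho$), and the iterations are well defined, then $y_k=Px_k$ for all $k\geq 0$.
   Context: Split-Merge iteration for the generalized eigenvalue problem of $(A,B)$, with parameter $\rho\ge 1$: $$x_{k+1}=\zeta_kB^{-1}Ax_k+\omega_kB^{-1}AB^{-1}Ax_k,$$ where $$\zeta_k=\frac{1}{2(x_k^TAx_k)^{1/2}}-\frac{1}{4\sigma_k\rho\,(x_k^TAx_k)}\,\frac{x_k^TAB^{-1}Ax_k}{x_k^TAx_k},\qquad \omega_k=\frac{1}{4\sigma_k\rho\,(x_k^TAx_k)},$$ $$\sigma_k=1-\frac{z_k^TB^{-1}z_k}{2\rho\,(x_k^TAx_k)^{1/2}\,\delta_k},\qquad z_k=AB^{-1}Ax_k-\frac{x_k^TAB^{-1}Ax_k}{x_k^TAx_k}Ax_k,$$ $$\delta_k=x_k^TAB^{-1}AB^{-1}Ax_k-\frac{(x_k^TAB^{-1}Ax_k)^2}{x_k^TAx_k}.$$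 Split-Merge iteration for the standard eigenvalue problem of a symmetric positive semidefinite matrix $\tilde A$, with parameter $\rho\geq 1$: $$y_{k+1}=\tilde\zeta_k\tilde Ay_k+\tilde\omega_k\tilde A^2y_k,$$ where $$\tilde\zeta_k=\frac{1}{2(y_k^T\tilde Ay_k)^{1/2}}-\frac{1}{4\tilde\sigma_k\rho\,(y_k^T\tilde Ay_k)}\,\frac{y_k^T\tilde A^2y_k}{y_k^T\tilde Ay_k},\qquad \tilde\omega_k=\frac{1}{4\tilde\sigma_k\rho\,(y_k^T\tilde Ay_k)},$$ $$\tilde\sigma_k=1-\frac{\left\|\tilde A^2y_k-\frac{y_k^T\tilde A^2y_k}{y_k^T\tilde Ay_k}\tilde Ay_k\right\|^2}{2\rho\,(y_k^T\tilde Ay_k)^{1/2}\left(y_k^T\tilde A^3y_k-\frac{(y_k^T\tilde A^2y_k)^2}{y_k^T\tilde Ay_k}\right)}.$$ An iteration is well defined if all denominators occurring in it are nonzero at every step. $P^{-T}$ denotes $(P^{-1})^T$. *)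

(* Defs.v *)
From mathcomp Require Import all_boot all_order all_algebra.
From mathcomp Require Import reals.

Set Implicit Arguments.
Unset Strict Implicit.
Unset Printing Implicit Defensive.

Import Order.TTheory GRing.Theory Num.Theory.
Local Open Scope ring_scope.

Section SplitMerge.

Variables (R : realType) (n : nat).
Implicit Types (A B M P : 'M[R]_n) (u v x y : 'cV[R]_n) (rho : R).

Definition bform M u v : R := (u^T *m M *m v) 0 0.

(* The canonical norm on matrices in MathComp-Analysis is the sup norm. *)
Definition norm2 v : R := Num.sqrt (\sum_i v i 0 ^+ 2).

Definition psdmx M : Prop :=
  M \is symmetricmx /\ forall x, 0 <= bform M x x.

Definition pdmx M : Prop :=
  M \is symmetricmx /\ forall x, x != 0 -> 0 < bform M x x.

Definition congr_inv P M : 'M[R]_n := (invmx P)^T *m M *m invmx P.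

(* gsm_*: the iteration for (A, B); sm_*: the iteration for a single matrix. *)
Definition gsm_a A x : R := bform A x x.

Definition gsm_b A B x : R := bform (A *m invmx B *m A) x x.

Definition gsm_z A B x : 'cV[R]_n :=
  A *m invmx B *m A *m x - (gsm_b A B x / gsm_a A x) *: (A *m x).

Definition gsm_delta A B x : R :=
  bform (A *m invmx B *m A *m invmx B *m A) x x
  - gsm_b A B x ^+ 2 / gsm_a A x.

Definition gsm_sigma A B rho x : R :=
  1 - bform (invmx B) (gsm_z A B x) (gsm_z A B x)
      / (2 * rho * Num.sqrt (gsm_a A x) * gsm_delta A B x).

Definition gsm_omega A B rho x : R :=
  1 / (4 * gsm_sigma A B rho x * rho * gsm_a A x).

Definition gsm_zeta A B rho x : R :=
  1 / (2 * Num.sqrt (gsm_a A x))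
  - 1 / (4 * gsm_sigma A B rho x * rho * gsm_a A x)
    * (gsm_b A B x / gsm_a A x).

Definition gsm_step A B rho x : 'cV[R]_n :=
  gsm_zeta A B rho x *: (invmx B *m A *m x)
  + gsm_omega A B rho x *: (invmx B *m A *m invmx B *m A *m x).

Definition gsm_iteration A B rho (x : nat -> 'cV[R]_n) : Prop :=
  forall k, x k.+1 = gsm_step A B rho (x k).

(* Division by 0 is total, so well-definedness is an explicit condition. *)
Definition gsm_well_defined A B rho (x : nat -> 'cV[R]_n) : Prop :=
  forall k,
    [/\ gsm_a A (x k) != 0,
        2 * Num.sqrt (gsm_a A (x k)) != 0,
        2 * rho * Num.sqrt (gsm_a A (x k)) * gsm_delta A B (x k) != 0
      & 4 * gsm_sigma A B rho (x k) * rho * gsm_a A (x k) != 0].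

Definition sm_a A y : R := bform A y y.

Definition sm_b A y : R := bform (A ^+ 2) y y.

Definition sm_delta A y : R :=
  bform (A ^+ 3) y y - sm_b A y ^+ 2 / sm_a A y.

Definition sm_sigma A rho y : R :=
  1 - norm2 (A ^+ 2 *m y - (sm_b A y / sm_a A y) *: (A *m y)) ^+ 2
      / (2 * rho * Num.sqrt (sm_a A y) * sm_delta A y).

Definition sm_omega A rho y : R :=
  1 / (4 * sm_sigma A rho y * rho * sm_a A y).

Definition sm_zeta A rho y : R :=
  1 / (2 * Num.sqrt (sm_a A y))
  - 1 / (4 * sm_sigma A rho y * rho * sm_a A y) * (sm_b A y / sm_a A y).

Definition sm_step A rho y : 'cV[R]_n :=
  sm_zeta A rho y *: (A *m y) + sm_omega A rho y *: (A ^+ 2 *m y).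

Definition sm_iteration A rho (y : nat -> 'cV[R]_n) : Prop :=
  forall k, y k.+1 = sm_step A rho (y k).

Definition sm_well_defined A rho (y : nat -> 'cV[R]_n) : Prop :=
  forall k,
    [/\ sm_a A (y k) != 0,
        2 * Num.sqrt (sm_a A (y k)) != 0,
        2 * rho * Num.sqrt (sm_a A (y k)) * sm_delta A (y k) != 0
      & 4 * sm_sigma A rho (y k) * rho * sm_a A (y k) != 0].

End SplitMerge.

(* Main.v *)
(** The hypothesis forces [B = P^T P], hence [B^-1 = Q Q^T] with [Q = P^-1].
    Then [Ã P x = Q^T A x] and each extra factor [Ã] inserts a factor [A B^-1]:
    [Ã^2 P x = Q^T A B^-1 A x].  All scalars of the two iterations therefore
    agree, as [|Q^T z|^2 = z^T B^-1 z], and [P B^-1 = Q^T] carries one step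
    for [(A, B)] to one step for [Ã]. *)
Require Import Defs.
From mathcomp Require Import all_boot all_order all_algebra.
From mathcomp Require Import reals.

Import Order.TTheory GRing.Theory Num.Theory.
Local Open Scope ring_scope.

Section CongruenceTransform.

Context {R : realType} {n : nat}.
Implicit Types (A B M N P : 'M[R]_n) (u v x z : 'cV[R]_n).

Lemma norm2_sqr v : norm2 v ^+ 2 = (v^T *m v) 0 0.
Proof.
rewrite sqr_sqrtr ?sumr_ge0 // => [|i _]; last exact: sqr_ge0.
by rewrite mxE; apply: eq_bigr => i _; rewrite mxE expr2.
Qed.

(** Multiplying the normalization by [P^T] on the left gives [B P^-1 = P^T]. Hence [P^-1 P^-T] is a
    right inverse of [B], and for square matrices a right inverse is the inverse. *)
Lemma invmx_congr_inv1 B P :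
  P \in unitmx -> congr_inv P B = 1%:M -> invmx B = invmx P *m (invmx P)^T.
Proof.
move=> uP BI; have BP : B *m invmx P = P^T.
  rewrite -[RHS]mulmx1 -BI /congr_inv -mulmxA [RHS]mulmxA -trmx_mul mulVmx //.
  by rewrite trmx1 mul1mx.
have BV : B *m (invmx P *m (invmx P)^T) = 1%:M.
  by rewrite mulmxA BP -trmx_mul mulVmx // trmx1.
have [uB _] := mulmx1_unit BV.
by rewrite -[RHS](mulKmx uB) BV mulmx1.
Qed.

Lemma congr_inv_mul M N P :
  congr_inv P M *m congr_inv P N
  = congr_inv P (M *m (invmx P *m (invmx P)^T) *m N).
Proof. by rewrite /congr_inv !mulmxA. Qed.

Lemma congr_inv_mulmx M P x :
  P \in unitmx -> congr_inv P M *m (P *m x) = (invmx P)^T *m (M *m x).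
Proof. by move=> uP; rewrite /congr_inv -!mulmxA mulKmx. Qed.

Lemma bform_congr_inv M P u v :
  P \in unitmx -> bform (congr_inv P M) (P *m u) (P *m v) = bform M u v.
Proof.
move=> uP; rewrite /bform -mulmxA congr_inv_mulmx // mulmxA -trmx_mul mulKmx //.
by rewrite mulmxA.
Qed.

(** For [N = P^-1] this turns the Euclidean norm in [sm_sigma] into the [B^-1]-form in
    [gsm_sigma]. *)
Lemma norm2_trmx_mul N z :
  norm2 (N^T *m z) ^+ 2 = bform (N *m N^T) z z.
Proof. by rewrite norm2_sqr /bform trmx_mul trmxK !mulmxA. Qed.

(** The scalars are matched in order of dependence, numerators and denominators separately, so no
    fraction is ever simplified. *)
Lemma sm_step_congr_inv A B P rho x :
    P \in unitmx -> congr_inv P B = 1%:M ->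
  sm_step (congr_inv P A) rho (P *m x) = P *m gsm_step A B rho x.
Proof.
move=> uP BI; have BV := invmx_congr_inv1 _ _ uP BI.
have A2 : congr_inv P A ^+ 2 = congr_inv P (A *m invmx B *m A).
  by rewrite expr2 BV -congr_inv_mul.
have A3 : congr_inv P A ^+ 3
    = congr_inv P (A *m invmx B *m A *m invmx B *m A).
  by rewrite exprSr A2 BV -[RHS]congr_inv_mul.
have Ea : sm_a (congr_inv P A) (P *m x) = gsm_a A x by exact: bform_congr_inv.
have Eb : sm_b (congr_inv P A) (P *m x) = gsm_b A B x.
  by rewrite /sm_b A2 bform_congr_inv.
have Ed : sm_delta (congr_inv P A) (P *m x) = gsm_delta A B x.
  by rewrite /sm_delta A3 bform_congr_inv // Ea Eb.
have Es : sm_sigma (congr_inv P A) rho (P *m x) = gsm_sigma A B rho x.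
  (* Both terms of the residual carry the left factor [P^-T]; pulling it out leaves [P^-T z] with
     [z = gsm_z A B x]. *)
  rewrite /sm_sigma Ea Eb Ed A2 !congr_inv_mulmx // scalemxAr -mulmxBr.
  by rewrite norm2_trmx_mul -BV.
have PBV : P *m invmx B = (invmx P)^T by rewrite BV mulKVmx.
rewrite /sm_step /sm_zeta /sm_omega Ea Eb Es A2 !congr_inv_mulmx //.
by rewrite /gsm_step mulmxDr -!scalemxAr !mulmxA PBV.
Qed.

End CongruenceTransform.

Theorem theorem4p5 (R : realType) (n : nat) (A B P : 'M[R]_n) (rho : R)
    (x y : nat -> 'cV[R]_n)
    (hA : psdmx A) (hB : pdmx B) (hrho : 1 <= rho)
    (hP : P \in unitmx) (hBI : congr_inv P B = 1%:M)
    (hxy0 : y 0%N = P *m x 0%N)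
    (hx : gsm_iteration A B rho x)
    (hy : sm_iteration (congr_inv P A) rho y)
    (hxwd : gsm_well_defined A B rho x)
    (hywd : sm_well_defined (congr_inv P A) rho y) :
  forall k : nat, y k = P *m x k.
Proof.
elim=> [//|k IHk].
by rewrite hy hx IHk (sm_step_congr_inv _ _ _ _ _ hP hBI).
Qed.
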